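(* Let $n>2$ be a natural number. The orbit $D_{2n}v$ is a full spark frame for almost every vector $v\in\mathbb{C}^n$ (with respect to the Lebesgue measure) if and only if $n$ is odd.
   Context: Coordinates of vectors in $\mathbb{C}^n$ are indexed by $\mathbb{Z}_n=\{0,1,\dots,n-1\}$. Let $T,D\in GL(n,\mathbb{C})$ be the permutation matrices acting by $(Tv)(j)=v((j-1)\bmod n)$ and $(Dv)(j)=v((n-j)\bmod n)$ for $v\in\mathbb{C}^n$, $j\in\mathbb{Z}_n$. $D_{2n}$ is the (dihedral) subgroup of $GL(n,\mathbb{C})$ generated by $T$ and $D$; it has order $2n$ for $n>2$. For $v\in\mathbb{C}^n$, $D_{2n}v=\{gv: g\in D_{2n}\}$ is the orbit of $v$. A set $\mathfrak{F}$ of $m\ge n$ vectors in $\mathbb{C}^n$ is called a full spark frame (or is said to have the Haar property) if every subset of $\mathfrak{F}$ of cardinality $n$ is a basis of $\mathbb{C}^n$. *)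

(* Defs.v *)
From HB Require Import structures.
From mathcomp Require Import all_boot all_order all_algebra.
From mathcomp Require Import perm finmap.
From mathcomp Require Import all_classical all_reals all_analysis.
From mathcomp Require Import complex.

Set Implicit Arguments.
Unset Strict Implicit.
Unset Printing Implicit Defensive.

Import Order.TTheory GRing.Theory Num.Theory.
Import numFieldNormedType.Exports.

Local Open Scope classical_set_scope.
Local Open Scope ring_scope.

(** Lebesgue measure on R^k, carried by the k-tuples with their product (Borel)
    sigma-algebra: the Dirac measure for k = 0, and the image of
    lebesgue_measure \x (Lebesgue measure on R^k) under
    (x, w) |-> x :: w for k.+1. *)
Section tuple_lebesgue.
Variable R : realType.
Local Notation M := (measurableTypeR R).

Definition tuple_consp k (p : M * k.-tuple M) : k.+1.-tuple M :=
  [the k.+1.-tuple M of p.1 :: p.2].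

Lemma measurable_tuple_consp k : measurable_fun setT (@tuple_consp k).
Proof. by apply: measurable_cons. Qed.

Section step.
Variables (k : nat) (mu : {sigma_finite_measure set (k.-tuple M) -> \bar R}).

Definition tuple_product_step : set (k.+1.-tuple M) -> \bar R :=
  pushforward (lebesgue_measure \x mu)%E (@tuple_consp k).

Let step0 : tuple_product_step set0 = 0%E.
Proof. by rewrite /tuple_product_step /pushforward preimage_set0 measure0. Qed.

Let step_ge0 A : (0 <= tuple_product_step A)%E.
Proof. exact: (measure_ge0 (lebesgue_measure \x mu)%E). Qed.

Let step_sigma_additive : semi_sigma_additive tuple_product_step.
Proof.
have mpre B : measurable B -> measurable (@tuple_consp k @^-1` B).
  by move=> mB; rewrite -[X in measurable X]setTI; exact: measurable_tuple_consp.
move=> F mF tF mUF; rewrite /tuple_product_step /pushforward preimage_bigcup.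
apply: measure_semi_sigma_additive => [i||]; first exact: mpre.
- by move=> i j _ _ [p [Fip Fjp]]; apply: tF => //; exists (tuple_consp p).
- by rewrite -preimage_bigcup; exact: mpre.
Qed.

HB.instance Definition _ := isMeasure.Build _ _ _ tuple_product_step
  step0 step_ge0 step_sigma_additive.

Let tuple_product_step_sigma_finite : sigma_finite setT tuple_product_step.
Proof.
have /sigma_finiteP[F [FT ndF Foo]] := sigma_finiteT (@lebesgue_measure R).
have /sigma_finiteP[G [GT ndG Goo]] := sigma_finiteT mu.
pose g (w : k.+1.-tuple M) : M * k.-tuple M := (thead w, [tuple of behead w]).
have gK p : g (tuple_consp p) = p.
  by case: p => x w; congr (_, _); exact/val_inj.
have mg : measurable_fun setT g.
  by apply: measurable_fun_pair; [exact: measurable_tnth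
                                 |exact: measurable_behead].
exists (fun i => g @^-1` (F i `*` G i)).
  rewrite -preimage_bigcup -[LHS](preimage_setT g); congr (_ @^-1` _).
  apply/esym/seteqP; split=> // -[x y] _.
  have [i _ Fix] : (\bigcup_i F i) x by rewrite -FT.
  have [j _ Gjy] : (\bigcup_i G i) y by rewrite -GT.
  exists (maxn i j) => //; split => /=.
    by move: x Fix; exact/subsetPset/ndF/leq_maxl.
  by move: y Gjy; exact/subsetPset/ndG/leq_maxr.
move=> i; have [mF Fi] := Foo i; have [mG Gi] := Goo i; split.
  by rewrite -[X in measurable X]setTI; apply: mg => //; exact: measurableX.
rewrite /tuple_product_step /pushforward.
rewrite (_ : _ @^-1` _ = F i `*` G i).
  by rewrite product_measure1E// lte_mul_pinfty// ge0_fin_numE.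
by rewrite -comp_preimage (_ : g \o _ = id)//; exact/funext.
Qed.

HB.instance Definition _ := Measure_isSigmaFinite.Build _ _ _
  tuple_product_step tuple_product_step_sigma_finite.

End step.

Fixpoint tuple_lebesgue k : {sigma_finite_measure set (k.-tuple M) -> \bar R} :=
  if k is k'.+1 then tuple_product_step (tuple_lebesgue k')
  else \d_([tuple] : 0.-tuple M).

Lemma tuple_lebesgue_box k (A : 'I_k -> set M) :
  (forall i, measurable (A i)) ->
  @tuple_lebesgue k [set w | forall i, A i (tnth w i)] =
  (\prod_(i < k) lebesgue_measure (A i))%E.
Proof.
elim: k => [|k IH] in A * => mA.
  have -> : [set w : 0.-tuple M | forall i, A i (tnth w i)] = setT.
    by apply/seteqP; split=> // w _ [].
  by rewrite big_ord0 /= diracT.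
rewrite big_ord_recl -IH//= /tuple_product_step /pushforward -product_measure1E//.
  congr (_ _); apply/seteqP; split=> [[x w]/= Aw|[x w]/= [Ax Aw] i].
    split; first exact: (Aw ord0).
    by move=> i; have := Aw (lift ord0 i); rewrite tnthS.
  by case: (unliftP ord0 i) => [j ->|->]; rewrite ?tnthS//; exact: Aw.
suff -> : [set w : k.-tuple M | forall i, A (lift ord0 i) (tnth w i)] =
    \big[setI/setT]_(i < k) ((@tnth _ M)^~ i @^-1` A (lift ord0 i)).
  apply: bigsetI_measurable => i _; rewrite -[X in measurable X]setTI.
  exact: measurable_tnth.
apply/seteqP; split=> w /=.
  by move=> Aw; elim/big_ind: _ => //= B D Bw Dw; split.
by move=> + i; rewrite (bigD1 i)//= => -[].
Qed.

End tuple_lebesgue.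

Section dihedral_orbits.
Variable R : realType.
Local Notation C := R[i].
Variable n : nat.

(** The identification of R^(n + n) with C^n: real parts first, then imaginary
    parts. *)
Definition cvec_of_tuple (x : (n + n).-tuple (measurableTypeR R)) : 'cV[C]_n :=
  \col_j Complex (tnth x (lshift n j)) (tnth x (rshift n j)).

Definition ae_cvec (P : 'cV[C]_n -> Prop) : Prop :=
  {ae @tuple_lebesgue R (n + n), forall x, P (cvec_of_tuple x)}.

Definition shift_mx : 'M[C]_n :=
  \matrix_(j, k) (k == (j + n - 1) %% n :> nat)%N%:R.

Definition refl_mx : 'M[C]_n :=
  \matrix_(j, k) (k == (n - j) %% n :> nat)%N%:R.

Lemma shift_mxE (v : 'cV[C]_n) j : (shift_mx *m v) j 0 = v (ord_pred j) 0.
Proof.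
rewrite mxE (bigD1 (ord_pred j))//= mxE subn1 eqxx mul1r big1 ?addr0// => k.
by rewrite mxE subn1 -val_eqE /= => /negbTE ->; rewrite mul0r.
Qed.

Lemma refl_mxE (v : 'cV[C]_n) (j k : 'I_n) :
  k = ((n - j) %% n)%N :> nat -> (refl_mx *m v) j 0 = v k 0.
Proof.
move=> kE; rewrite mxE (bigD1 k)//= mxE kE eqxx mul1r big1 ?addr0// => i.
by rewrite mxE -val_eqE /= kE => /negbTE ->; rewrite mul0r.
Qed.

Definition GL_subgroup (H : set 'M[C]_n) : Prop :=
  [/\ forall A, H A -> A \in unitmx,
      H 1%:M,
      forall A B, H A -> H B -> H (A *m B) &
      forall A, H A -> H (invmx A)].

Definition dihedral : set 'M[C]_n :=
  smallest GL_subgroup [set shift_mx; refl_mx].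

Lemma shift_mx_unit : shift_mx \in unitmx.
Proof.
suff -> : shift_mx = perm_mx (perm (@ord_pred_inj n)) by exact: unitmx_perm.
by apply/matrixP => j k; rewrite !mxE permE -val_eqE /= subn1 eq_sym.
Qed.

Lemma refl_mx_unit : refl_mx \in unitmx.
Proof.
suff /mulmx1_unit[] : refl_mx *m refl_mx = 1%:M by [].
apply/matrixP => j k; have n_gt0 : (0 < n)%N by case: (n) j => [[]|].
pose refl_ord (i : 'I_n) : 'I_n := Ordinal (ltn_pmod (n - i) n_gt0).
have reflK : refl_ord (refl_ord j) = j.
  apply/val_inj => /=; have [j0|j_gt0] := posnP j.
    by rewrite j0 subn0 modnn subn0 modnn.
  by rewrite (modn_small (m := n - j)) ?subKn ?modn_small// ?ltn_subrL ?j_gt0//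
    ltnW.
have entryE (A : 'M[C]_n) : A j k = (A *m delta_mx k 0 : 'cV_n) j 0.
  by rewrite -colE mxE.
rewrite entryE -mulmxA (refl_mxE _ (k := refl_ord j))//.
by rewrite (refl_mxE _ (k := refl_ord (refl_ord j)))// reflK !mxE andbT.
Qed.

Lemma dihedral_GL_subgroup : GL_subgroup dihedral.
Proof.
have GLT : GL_subgroup [set A | A \in unitmx].
  split=> [A|| A B|A] //=; rewrite ?unitmx1 ?unitmx_inv//.
  by move=> uA uB; rewrite unitmx_mul uA.
split=> [A dA||A B dA dB|A dA].
- apply: (dA [set B | B \in unitmx]); split=> // _ [->|->]; [exact: shift_mx_unit|exact: refl_mx_unit].
- by move=> H [[_ ? _ _] _].
- move=> H HH; have [[_ _ HM _] _] := HH.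
  by apply: HM; [exact: dA|exact: dB].
- by move=> H HH; have [[_ _ _ HV] _] := HH; apply: HV; exact: dA.
Qed.

Definition dihedral_orbit (v : 'cV[C]_n) : set 'cV[C]_n :=
  [set g *m v | g in dihedral].

Definition full_spark_frame (F : set 'cV[C]_n) : Prop :=
  (exists2 m, (n <= m)%N & (F #= `I_m)%card) /\
  forall S : {fset 'cV[C]_n}, [set` S] `<=` F -> #|` S|%fset = n ->
    basis_of fullv S.

End dihedral_orbits.

(* Main.v *)
Require Import Defs.
From mathcomp Require Import all_boot all_order all_algebra.
From mathcomp Require Import all_solvable all_field.
From mathcomp Require Import finmap.
From mathcomp Require Import all_classical all_reals all_analysis.
From mathcomp Require Import complex measurable_realfun.
From mathcomp Require Import ring zify.

(** Write T^k and T^k D for the 2n elements of the dihedral group; on a vector v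
    they act by j |-> v(j - k) and j |-> v(k - j). When the coordinates of v are
    pairwise distinct and n > 2, these 2n images of v are distinct, so that the
    orbit is a full spark frame exactly when, for every n-element set E of group
    elements, the vectors g v with g in E are linearly independent
    ([full_sparkP]).

    For n even, reflections preserve the parity of indices, whence the operator
    identity: the sum of T^k over even k equals the sum of T^k D over even k
    ([even_relation]). It involves exactly n group elements, so the independence
    above fails for every v, and almost every v has distinct coordinates.

    For n odd, fix E. The determinant of the family (g v), g in E, is a
    polynomial in the real and imaginary parts of v, and the zero set of a
    nonzero polynomial is null ([mpoly_fun_zeros_null], by induction on the
    number of variables with Fubini). There are finitely many E, so it suffices
    to find, for each E, one v for which the family is independent
    ([rotations_reflections_indep]). Say E consists of T^a for a in A and T^b D
    for b in B, with |A| + |B| = n; exactly one of the two sets has less than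
    n/2 elements because n is odd, and by symmetry let it be B. In Fourier
    coordinates T^a v has l-th coordinate w^(la) z(l) and T^b D v has l-th
    coordinate w^(lb) z(-l), with w a primitive n-th root of unity and z the
    transform of v. Choose z(l) = 0 for l = 1, ..., |B| and z(l) = 1 elsewhere.
    As 2|B| < n, the negatives of 1, ..., |B| lie outside this interval.
    On the rows 1, ..., |B| a linear relation only sees the coefficients of the
    reflections and is a Vandermonde system with |B| consecutive exponents, so
    these coefficients vanish; the remaining |A| rows are consecutive modulo n
    and form a Vandermonde system for the coefficients of the rotations. *)

Set Implicit Arguments.
Unset Strict Implicit.
Unset Printing Implicit Defensive.

Import Order.TTheory GRing.Theory Num.Theory.

Local Open Scope ring_scope.

(** * Vandermonde systems and the discrete Fourier transform *)

(** The hypothesis extends linearly from the monomials x^k0, ..., x^(k0+|A|-1)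
    to x^k0 p(x) for every polynomial p of degree less than |A|; the product of
    the X - x_j over the j in A other than i isolates c_i. *)
Lemma vandermonde_consecutive (F : fieldType) (I : finType) (x : I -> F)
    (A : {set I}) (c : I -> F) (k0 : nat) :
  injective x -> (forall i, x i != 0) ->
  (forall k, (k < #|A|)%N -> \sum_(i in A) c i * x i ^+ (k0 + k) = 0) ->
  forall i, i \in A -> c i = 0.
Proof.
move=> x_inj x_neq0 sum0 i iA.
pose p := \prod_(y <- [seq x j | j <- enum (A :\ i)]) ('X - y%:P).
have size_p : size p = #|A|.
  by rewrite size_prod_XsubC size_map -cardE (cardsD1 i A) iA.
have rootp j : root p (x j) = (j \in A :\ i).
  by rewrite root_prod_XsubC mem_map// mem_enum.
have: \sum_(j in A) c j * x j ^+ k0 * p.[x j] = 0.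
  transitivity (\sum_(k < #|A|) p`_k * \sum_(j in A) c j * x j ^+ (k0 + k)).
    under [RHS]eq_bigr do rewrite mulr_sumr.
    rewrite exchange_big /=; apply: eq_bigr => j _.
    rewrite horner_coef size_p mulr_sumr; apply: eq_bigr => k _.
    by rewrite exprD; ring.
  by rewrite big1// => k _; rewrite sum0 ?mulr0.
rewrite (bigD1 i)//= big1 ?addr0 => [/eqP|j /andP[jA j_neqi]]; last first.
  rewrite (_ : p.[x j] = 0) ?mulr0//; apply/eqP.
  by have := rootp j; rewrite !inE j_neqi jA.
have pi_neq0 : p.[x i] != 0 by have := rootp i; rewrite !inE eqxx /root => ->.
rewrite !mulf_eq0 expf_eq0 (negPf (x_neq0 i)) (negPf pi_neq0) andbF !orbF.
by move=> /eqP.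
Qed.

(** In characteristic zero X^n - 1 is separable, hence has n distinct roots, and
    a finite subgroup of the multiplicative group of a field is cyclic. *)
Lemma closed_prim_root_exists (C : numClosedFieldType) n :
  (0 < n)%N -> exists w : C, n.-primitive_root w.
Proof.
move=> n_gt0; have [r] := closed_field_poly_normal ('X^n - 1 : {poly C}).
rewrite (monicP _) ?monicXnsubC// scale1r => rE.
have r_roots : all n.-unity_root r.
  by apply/allP => z; rewrite -root_prod_XsubC -rE.
have size_r : (n < (size r).+1)%N.
  by rewrite -(size_prod_XsubC r id) -rE size_XnsubC.
have [|w] := hasP (has_prim_root n_gt0 r_roots _ size_r); last by exists w.
by rewrite -separable_prod_XsubC -rE separable_Xn_sub_1 // pnatr_eq0 -lt0n.
Qed.

Section fourier.
Variables (F : fieldType) (m : nat).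
Local Notation n := m.+1.
Variable w : F.
Hypothesis w_prim : n.-primitive_root w.
Implicit Types j k l : 'I_n.

Definition chi l j : F := w ^+ (l * j).

Lemma chiC l j : chi l j = chi j l.
Proof. by rewrite /chi mulnC. Qed.

Lemma chiE l j : chi l j = (w ^+ j) ^+ l.
Proof. by rewrite /chi mulnC exprM. Qed.

Lemma chiD l j k : chi l (j + k) = chi l j * chi l k.
Proof. by rewrite !chiE /= (prim_expr_mod w_prim) exprD exprMn. Qed.

Lemma chi0 l : chi l 0 = 1.
Proof. by rewrite /chi muln0. Qed.

Lemma chiN l j : chi (- l) j = chi l (- j).
Proof.
have chi_neq0 : chi l j != 0.
  by rewrite expf_neq0// (prim_root_eq0 w_prim).
apply: (mulfI chi_neq0); rewrite -chiD subrr chi0.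
by rewrite ![chi _ j]chiC -chiD subrr chi0.
Qed.

Lemma exp_prim_inj : injective (fun j => w ^+ j).
Proof.
move=> j k /= /eqP; rewrite (eq_prim_root_expr w_prim) !modn_small//.
by move=> /eqP/val_inj.
Qed.

Lemma exp_prim_neq0 j : w ^+ j != 0.
Proof. by rewrite expf_neq0// (prim_root_eq0 w_prim). Qed.

(** The Fourier matrix is a square Vandermonde matrix with distinct nodes. *)
Lemma fourier_surjective (z : 'I_n -> F) :
  exists v : 'I_n -> F, forall l, \sum_j chi l j * v j = z l.
Proof.
pose M : 'M[F]_n := \matrix_(l, j) chi l j.
have M_unit : M \in unitmx.
  rewrite unitmxE unitfE; apply/negP => /det0P[u u_neq0 uM0].
  case/negP: u_neq0; apply/eqP/rowP => l; rewrite mxE.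
  apply: (vandermonde_consecutive (c := u 0) (A := [set: 'I_n]%SET) (k0 := 0)
            exp_prim_inj exp_prim_neq0) (finset.in_setT l) => k.
  rewrite cardsT card_ord => kn.
  have := congr1 (fun r : 'rV_n => r 0 (Ordinal kn)) uM0.
  rewrite !mxE => uM0k; rewrite -[RHS]uM0k.
  by apply: eq_big => [i|i _]; rewrite ?inE// mxE chiC chiE.
pose v := invmx M *m \col_l z l.
exists (fun j => v j 0) => l.
transitivity ((M *m v) l 0); last by rewrite mulKVmx ?mxE.
by rewrite [RHS]mxE; apply: eq_bigr => j _; rewrite [M l j]mxE.
Qed.

Lemma fourier_rotation (v : 'I_n -> F) l a :
  \sum_j chi l j * v (j - a) = chi l a * \sum_j chi l j * v j.
Proof.
rewrite (reindex_inj (addIr a)) /= mulr_sumr.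
by apply: eq_bigr => j _; rewrite addrK chiD; ring.
Qed.

Lemma fourier_reflection (v : 'I_n -> F) l b :
  \sum_j chi l j * v (b - j) = chi l b * \sum_j chi (- l) j * v j.
Proof.
rewrite (reindex_inj (inj_comp (addrI b) oppr_inj)) /= mulr_sumr.
by apply: eq_bigr => j _; rewrite subKr chiD -chiN; ring.
Qed.

(** The transform of v vanishes exactly at 1, ..., q. This decouples the
    coefficients: at the frequencies 1, ..., q only the reflections survive, and
    once their coefficients are known to be zero, the frequencies q + 1, ..., n
    (the last one being 0 modulo n) determine the rotations. *)
Lemma rotations_reflections_indep (A B : {set 'I_n}) p q :
  #|A| = p -> #|B| = q -> (p + q = n)%N -> (q.*2 < n)%N ->
  exists v : 'I_n -> F, forall alpha beta : 'I_n -> F,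
    (forall j, \sum_(a in A) alpha a * v (j - a) +
               \sum_(b in B) beta b * v (b - j) = 0) ->
    (forall a, a \in A -> alpha a = 0) /\ (forall b, b \in B -> beta b = 0).
Proof.
move=> cardA cardB pq q_small.
pose z l : F := (~~ (0 < l <= q)%N)%:R.
have [v vE] := fourier_surjective z; exists v => alpha beta sum0.
have hat0 l : (\sum_(a in A) alpha a * chi l a) * z l +
              (\sum_(b in B) beta b * chi l b) * z (- l) = 0.
  transitivity (\sum_j chi l j * (\sum_(a in A) alpha a * v (j - a) +
                                  \sum_(b in B) beta b * v (b - j))).
    under [RHS]eq_bigr do rewrite mulrDr !mulr_sumr.
    rewrite big_split /= exchange_big/= [X in _ = _ + X]exchange_big/=.
    rewrite -!vE !mulr_suml; congr (_ + _); apply: eq_bigr => a _.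
      by rewrite -mulrA -fourier_rotation mulr_sumr; apply: eq_bigr => *; ring.
    by rewrite -mulrA -fourier_reflection mulr_sumr; apply: eq_bigr => *; ring.
  by rewrite big1// => j _; rewrite sum0 mulr0.
(* The frequency -(k + 1) has z = 1, as n - (k + 1) > q follows from 2 q < n. *)
have beta0 b : b \in B -> beta b = 0.
  apply: (vandermonde_consecutive exp_prim_inj exp_prim_neq0 (k0 := 1)) => k.
  rewrite cardB => kq.
  have kn : (k.+1 < n)%N by lia.
  have := hat0 (Ordinal kn).
  rewrite {1}/z /= kq mulr0 add0r /z /= modn_small; last by lia.
  have -> : (0 < n - k.+1 <= q)%N = false by lia.
  rewrite mulr1 => hat_l; rewrite -[RHS]hat_l; apply: eq_bigr => j _.
  by rewrite chiE.
split=> // a; move: a.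
apply: (vandermonde_consecutive exp_prim_inj exp_prim_neq0
          (k0 := q.+1)) => k.
rewrite cardA => kp.
have := hat0 (inZp (q.+1 + k)).
rewrite [X in _ + X * _]big1 => [|b bB]; last by rewrite beta0 ?mul0r.
rewrite mul0r addr0 {1}/z /=.
have -> : (0 < (q.+1 + k) %% n <= q)%N = false.
  have [ltn|gen] := ltnP (q.+1 + k) n; first by rewrite modn_small//; lia.
  by have -> : (q.+1 + k = n)%N by [lia|]; rewrite modnn.
rewrite mulr1 => hat_l; rewrite -[RHS]hat_l; apply: eq_bigr => j _.
by rewrite chiC chiE /= (prim_expr_mod w_prim) -!exprM mulnC.
Qed.

(** Replacing v by j |-> v(-j) exchanges the rotations and the reflections, so
    the smaller of the two families may play the role of the reflections; for n
    odd one of them has less than n/2 members. *)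
Lemma dihedral_family_indep (A B : {set 'I_n}) :
  odd n -> (#|A| + #|B| = n)%N ->
  exists v : 'I_n -> F, forall alpha beta : 'I_n -> F,
    (forall j, \sum_(a in A) alpha a * v (j - a) +
               \sum_(b in B) beta b * v (b - j) = 0) ->
    (forall a, a \in A -> alpha a = 0) /\ (forall b, b \in B -> beta b = 0).
Proof.
move=> n_odd cardAB; have [ltB|geB] := ltnP #|B|.*2 n.
  exact: rotations_reflections_indep cardAB ltB.
have ltA : (#|A|.*2 < n)%N.
  by rewrite ltn_neqAle; apply/andP; split; [|lia];
     apply/eqP => nE; move: n_odd; rewrite -nE odd_double.
have cardBA : (#|B| + #|A| = n)%N by rewrite addnC.
have [v vP] := rotations_reflections_indep erefl erefl cardBA ltA.
exists (fun j => v (- j)) => alpha beta sum0.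
have [j|beta0 alpha0] := vP beta alpha; last by split.
rewrite addrC -[RHS](sum0 j).
by congr (_ + _); apply: eq_bigr => i _; rewrite opprB.
Qed.

End fourier.

(** * Null sets of polynomial functions *)

Local Open Scope classical_set_scope.
Local Open Scope complex_scope.

Section polynomial_functions.
Variable R : realType.
Local Notation M := (measurableTypeR R).
Local Notation C := R[i].

(** Polynomial dependence on each coordinate separately, the other ones being
    fixed. It is all that the Fubini induction uses, and it is stable under
    freezing the first coordinate by construction. *)
Fixpoint coord_poly k : (k.-tuple M -> C) -> Prop :=
  if k is k'.+1 then fun f =>
    (forall u, exists p : {poly C}, forall x, f (tuple_consp (x, u)) = p.[x%:C])
    /\ forall x, coord_poly (fun u => f (tuple_consp (x, u)))
  else fun=> True.

(** Fubini needs measurable zero sets, and coordinatewise polynomial dependence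
    does not give measurability at once; it is carried along instead. *)
Definition mpoly_fun k (f : k.-tuple M -> C) : Prop :=
  [/\ measurable_fun setT (fun u => complex.Re (f u) : M),
      measurable_fun setT (fun u => complex.Im (f u) : M) & coord_poly f].

Lemma mpoly_fun_cst k (c : C) : mpoly_fun (fun _ : k.-tuple M => c).
Proof.
split=> //; elim: k => [//|k IH] /=; split=> // _.
by exists c%:P => x; rewrite hornerC.
Qed.

Lemma mpoly_funD k (f g : k.-tuple M -> C) :
  mpoly_fun f -> mpoly_fun g -> mpoly_fun (fun u => f u + g u).
Proof.
move=> [mRf mIf pf] [mRg mIg pg]; split.
- under eq_fun do rewrite raddfD /=; exact: measurable_funD.
- under eq_fun do rewrite raddfD /=; exact: measurable_funD.
elim: k => [//|k IH] /= in f g {mRf mIf mRg mIg} pf pg *.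
have [[pf0 pf1] [pg0 pg1]] := (pf, pg); split=> [u|x].
  have [[p pE] [q qE]] := (pf0 u, pg0 u).
  by exists (p + q) => x; rewrite hornerD pE qE.
exact: IH.
Qed.

Lemma ReM (x y : C) :
  complex.Re (x * y) = complex.Re x * complex.Re y -
                       complex.Im x * complex.Im y.
Proof. by case: x y => [a b] [c d]. Qed.

Lemma ImM (x y : C) :
  complex.Im (x * y) = complex.Re x * complex.Im y +
                       complex.Im x * complex.Re y.
Proof. by case: x y => [a b] [c d]. Qed.

Lemma mpoly_funM k (f g : k.-tuple M -> C) :
  mpoly_fun f -> mpoly_fun g -> mpoly_fun (fun u => f u * g u).
Proof.
move=> [mRf mIf pf] [mRg mIg pg]; split.
- under eq_fun do rewrite ReM.
  by apply: measurable_funB; apply: measurable_funM.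
- under eq_fun do rewrite ImM.
  by apply: measurable_funD; apply: measurable_funM.
elim: k => [//|k IH] /= in f g {mRf mIf mRg mIg} pf pg *.
have [[pf0 pf1] [pg0 pg1]] := (pf, pg); split=> [u|x].
  have [[p pE] [q qE]] := (pf0 u, pg0 u).
  by exists (p * q) => x; rewrite hornerM pE qE.
exact: IH.
Qed.

Lemma mpoly_fun_tnth k (i : 'I_k) :
  mpoly_fun (fun u : k.-tuple M => (tnth u i : R)%:C).
Proof.
split=> //=; first exact: measurable_tnth.
elim: k i => [[]//|k IH] i /=.
have [j ->|->] := unliftP ord0 i; split=> [u|x].
- by exists (tnth u j : R)%:C%:P => x; rewrite hornerC tnthS.
- by have := IH j; congr coord_poly; apply/funext => u; rewrite tnthS.
- by exists 'X => x; rewrite hornerX.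
- by have [_ _] := mpoly_fun_cst k x%:C.
Qed.

Lemma mpoly_fun_sum k (I : Type) (r : seq I) (P : pred I)
    (f : I -> k.-tuple M -> C) :
  (forall i, mpoly_fun (f i)) -> mpoly_fun (fun u => \sum_(i <- r | P i) f i u).
Proof.
move=> pf; elim: r => [|i r IH].
  by under eq_fun do rewrite big_nil; exact: mpoly_fun_cst.
under eq_fun do rewrite big_cons; case: (P i) => //.
exact: mpoly_funD.
Qed.

Lemma mpoly_fun_prod k (I : Type) (r : seq I) (P : pred I)
    (f : I -> k.-tuple M -> C) :
  (forall i, mpoly_fun (f i)) ->
  mpoly_fun (fun u => \prod_(i <- r | P i) f i u).
Proof.
move=> pf; elim: r => [|i r IH].
  by under eq_fun do rewrite big_nil; exact: mpoly_fun_cst.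
under eq_fun do rewrite big_cons; case: (P i) => //.
exact: mpoly_funM.
Qed.

Lemma mpoly_fun_det k p (A : k.-tuple M -> 'M[C]_p) :
  (forall i j, mpoly_fun (fun u => A u i j)) -> mpoly_fun (fun u => \det (A u)).
Proof.
move=> pA; apply: mpoly_fun_sum => s; apply: mpoly_funM.
  exact: mpoly_fun_cst.
by apply: mpoly_fun_prod => i; exact: pA.
Qed.

Lemma measurable_zeros k (f : k.-tuple M -> C) :
  mpoly_fun f -> measurable [set u | f u = 0].
Proof.
move=> [mRe mIm _].
rewrite (_ : [set u | f u = 0] =
    ((fun u => complex.Re (f u) : M) @^-1` [set 0]) `&`
    ((fun u => complex.Im (f u) : M) @^-1` [set 0])).
  by apply: measurableI; rewrite -[X in measurable X]setTI;
    [apply: mRe|apply: mIm].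
apply/seteqP; split=> u /= => [->//|].
by case: (f u) => a b /= [-> ->].
Qed.

Lemma real_roots_countable (p : {poly C}) :
  p != 0 -> countable [set x : M | p.[x%:C] = 0].
Proof.
move=> p_neq0; have [r rE] := closed_field_poly_normal p.
apply: finite_set_countable.
apply: (sub_finite_set (B := [set` [seq complex.Re z | z <- r]]));
  last exact: finite_seq.
move=> x /= /eqP px.
apply/mapP; exists x%:C => //.
move: px; rewrite rE hornerZ mulf_eq0 lead_coef_eq0 (negPf p_neq0) /=.
by rewrite -/(root _ _) root_prod_XsubC.
Qed.

Lemma mpoly_fun_section k (f : k.+1.-tuple M -> C) x :
  mpoly_fun f -> mpoly_fun (fun u => f (tuple_consp (x, u))).
Proof.
move=> [mRe mIm /= [_ ?]]; split=> //.
- apply: (measurableT_comp mRe) => /=.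
  apply: measurableT_comp; first exact: measurable_tuple_consp.
  exact: measurable_pair1.
- apply: (measurableT_comp mIm) => /=.
  apply: measurableT_comp; first exact: measurable_tuple_consp.
  exact: measurable_pair1.
Qed.

(** Let f(x0 :: w0) be nonzero. The polynomial x |-> f(x :: w0) is nonzero, so
    outside finitely many x the section f(x :: _) is nonzero at w0 and its zero
    set is null by induction; Fubini concludes. *)
Lemma mpoly_fun_zeros_null k (f : k.-tuple M -> C) u0 :
  mpoly_fun f -> f u0 != 0 -> tuple_lebesgue R k [set u | f u = 0] = 0%E.
Proof.
elim: k => [|k IH] /= in f u0 *.
  move=> _ fu0; rewrite (_ : [set u | f u = 0] = set0) ?measure0//.
  apply/seteqP; split=> // u /= /eqP.
  by rewrite (tuple0 u) -(tuple0 u0) (negPf fu0).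
move=> pf fu0; have [_ _ [/= fpoly _]] := pf.
pose Z := @tuple_consp R k @^-1` [set u | f u = 0].
have mZ : measurable Z.
  rewrite -[X in measurable X]setTI; apply: measurable_tuple_consp => //.
  exact: measurable_zeros.
have [p pE] := fpoly [tuple of behead u0].
have p_neq0 : p != 0.
  apply: contra_neq fu0 => p0; have := pE (thead u0); rewrite p0 horner0 => <-.
  by congr f; apply/val_inj; case/tupleP: u0 {p p0 pE}.
have secE x : xsection Z x = [set u | f (tuple_consp (x, u)) = 0].
  by apply/seteqP; split=> u; rewrite /xsection /= inE.
rewrite /tuple_product_step /pushforward -/Z /product_measure1.
rewrite (ae_eq_integral (cst 0%E)) ?integral0//.
- exact: measurable_fun_xsection.
exists [set x : M | p.[x%:C] = 0]; split; last 1 first.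
- move=> x /=; apply: contra_notP => px _.
  rewrite /= secE; apply: (IH _ [tuple of behead u0]).
    exact: mpoly_fun_section.
  by apply/eqP; rewrite pE.
- apply: countable_measurable; last exact: real_roots_countable.
  by move=> x; exact: measurable_set1.
- exact/countable_lebesgue_measure0/real_roots_countable.
Qed.

End polynomial_functions.

(** * The elements of the dihedral group *)

Section dihedral_elements.
Variables (R : realType) (m : nat).
Local Notation n := m.+1.
Local Notation C := R[i].
Local Notation G := (bool * 'I_n)%type.
Implicit Types (g h : G) (j k : 'I_n) (v : 'cV[C]_n).

(** The pair (false, k) stands for T^k and (true, k) for T^k D. *)
Definition dact g j : 'I_n := if g.1 then g.2 - j else j - g.2.

Definition dmx g : 'M[C]_n := \matrix_(j, k) (k == dact g j)%:R.

Lemma dmxE g v j : (dmx g *m v) j 0 = v (dact g j) 0.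
Proof.
rewrite mxE (bigD1 (dact g j))//= mxE eqxx mul1r big1 ?addr0// => k kN.
by rewrite mxE (negPf kN) mul0r.
Qed.

Definition dmul g h : G :=
  (g.1 (+) h.1, if g.1 then g.2 - h.2 else g.2 + h.2).

Lemma dact_dmul g h j : dact h (dact g j) = dact (dmul g h) j.
Proof.
case: g h => [[] k] [[] l]; rewrite /dact /=.
- by rewrite !opprB addrCA.
- by rewrite addrAC.
- by rewrite opprB addrA [l + k]addrC.
- by rewrite opprD addrA.
Qed.

Lemma dmxM g h : dmx g *m dmx h = dmx (dmul g h).
Proof.
apply/matrixP => j k.
rewrite mxE (bigD1 (dact g j))//= big1 => [|i iN]; last first.
  by rewrite mxE (negPf iN) mul0r.
by rewrite !mxE eqxx mul1r addr0 dact_dmul.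
Qed.

Lemma dmx1 : dmx (false, 0) = 1%:M.
Proof. by apply/matrixP => j k; rewrite !mxE /dact /= subr0 eq_sym. Qed.

Lemma dmxV g : dmx g *m dmx (if g.1 then g else (false, - g.2)) = 1%:M.
Proof. by rewrite dmxM -dmx1; case: g => [[] k]; rewrite /dmul /= subrr. Qed.

Hypothesis n_gt1 : (1 < n)%N.

Lemma shift_mx_dmx : Defs.shift_mx R n = dmx (false, inZp 1).
Proof.
apply/matrixP => j k; rewrite !mxE -val_eqE /= (modn_small n_gt1).
by rewrite (modn_small (m := n - 1)) ?addnBA//; lia.
Qed.

Lemma refl_mx_dmx : Defs.refl_mx R n = dmx (true, 0).
Proof. by apply/matrixP => j k; rewrite !mxE -val_eqE /= add0n modn_mod. Qed.

Lemma dihedralE : @dihedral R n = range dmx.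
Proof.
apply/seteqP; split.
  apply: smallest_sub; last first.
    by move=> _ [->|->]; [rewrite shift_mx_dmx|rewrite refl_mx_dmx]; eexists.
  split=> [_ [g _ <-]||_ _ [g _ <-] [h _ <-]|_ [g _ <-]].
  - by have /mulmx1_unit[] := dmxV g.
  - by exists (false, 0); rewrite // dmx1.
  - by exists (dmul g h); rewrite // dmxM.
  - exists (if g.1 then g else (false, - g.2)) => //.
    move: (if _ then _ else _) (dmxV g) => h gh.
    have [g_unit _] := mulmx1_unit gh.
    by rewrite -[LHS]mul1mx -(mulVmx g_unit) -mulmxA gh mulmx1.
have [_ D1 DM _] := dihedral_GL_subgroup R n.
have DT : @dihedral R n (dmx (false, inZp 1)).
  by rewrite -shift_mx_dmx => H [_]; apply; left.
have DD : @dihedral R n (dmx (true, 0)).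
  by rewrite -refl_mx_dmx => H [_]; apply; right.
have Drot k : @dihedral R n (dmx (false, k)).
  rewrite -[k]valZpK; elim: (k : nat) => [|i IH].
    by rewrite (_ : inZp 0 = 0) ?dmx1//; apply/val_inj; rewrite /= mod0n.
  rewrite (_ : dmx _ = dmx (false, inZp i) *m dmx (false, inZp 1)).
    exact: DM.
  rewrite dmxM /dmul /=; congr (dmx (_, _)); apply/val_inj => /=.
  by rewrite modnDm addn1.
move=> _ [[[] k] _ <-]; last exact: Drot.
rewrite (_ : dmx _ = dmx (false, k) *m dmx (true, 0)); first exact: DM.
by rewrite dmxM /dmul /= addr0.
Qed.

Lemma dihedral_orbitE v : dihedral_orbit v = range (fun g => dmx g *m v).
Proof.
rewrite /dihedral_orbit dihedralE; apply/seteqP; split=> [_ [_ [g _ <-] <-]|].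
  by exists g.
by move=> _ [g _ <-]; exists (dmx g) => //; exists g.
Qed.

Hypothesis n_gt2 : (2 < n)%N.

(** A rotation and a reflection can only agree on all indices if 2 = 0 modulo n,
    which is where n > 2 enters. *)
Lemma dmx_orbit_inj v :
  injective (fun j => v j 0) -> injective (fun g => dmx g *m v).
Proof.
move=> v_inj g h gh; have act_eq j : dact g j = dact h j.
  by apply: v_inj; rewrite -!dmxE gh.
have one_neq_opp : inZp 1 != - inZp 1 :> 'I_n.
  rewrite -addr_eq0 -val_eqE /= (modn_small n_gt1) modn_small//.
have mixed k l : ~ (forall j, k - j = j - l).
  move=> kl; case/negP: one_neq_opp; apply/eqP.
  have := kl (inZp 1); have := kl 0; rewrite subr0 sub0r => ->.
  by rewrite addrC => /addIr ->.
case: g h act_eq {gh} => [[] k] [[] l]; rewrite /dact /= => act_eq.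
- by congr (_, _); have := act_eq 0; rewrite !subr0.
- by case: (mixed _ _ act_eq).
- by case: (mixed l k) => j; rewrite act_eq.
- by congr (_, _); have := act_eq 0; rewrite !sub0r => /oppr_inj.
Qed.

End dihedral_elements.

(** * Full spark orbits and linear independence *)

Lemma free_imageP (K : fieldType) (vT : vectType K) (T : finType)
    (f : T -> vT) (E : {set T}) :
  free [seq f x | x <- enum E] <->
  forall c : T -> K, \sum_(x in E) c x *: f x = 0 ->
    forall x, x \in E -> c x = 0.
Proof.
have -> : [seq f x | x <- enum E] = [tuple f (enum_val i) | i < #|E|].
  apply: (@eq_from_nth _ 0) => [|i]; first by rewrite !size_tuple.
  rewrite size_map -cardE => iE.
  have x0 : T := enum_val (Ordinal iE).
  rewrite (nth_map x0) -?cardE//.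
  by rewrite -(tnth_nth 0 _ (Ordinal iE)) tnth_mktuple (enum_val_nth x0).
split=> [/freeP freeE c c0 x xE|indep].
  rewrite -(enum_rankK_in xE xE).
  apply: (freeE (fun i => c (enum_val i))); rewrite -[RHS]c0 [RHS]big_enum_val.
  by apply: eq_bigr => i _; rewrite -tnth_nth tnth_mktuple.
apply/freeP => k k0 i.
pose c x := k (enum_rank_in (enum_valP i) x).
have cE j : c (enum_val j) = k j by rewrite /c enum_valK_in.
rewrite -cE; apply: indep (enum_valP i); rewrite -[RHS]k0 [LHS]big_enum_val.
by apply: eq_bigr => j _; rewrite cE -tnth_nth tnth_mktuple.
Qed.

(** When the vectors g v are distinct, the n-element subsets of the orbit
    correspond to the n-element sets of group elements. *)
Lemma full_sparkP (R : realType) (m : nat) (v : 'cV[R[i]]_m.+1) :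
  (2 < m.+1)%N -> injective (fun g => dmx R g *m v) ->
  full_spark_frame (dihedral_orbit v) <->
  forall E : {set bool * 'I_m.+1}, #|E| = m.+1 ->
  forall c : bool * 'I_m.+1 -> R[i],
    \sum_(g in E) c g *: (dmx R g *m v) = 0 -> forall g, g \in E -> c g = 0.
Proof.
move=> n_gt2 f_inj; have n_gt1 := ltnW n_gt2.
rewrite /full_spark_frame dihedral_orbitE//.
set f := (fun g => dmx R g *m v) in f_inj *.
split=> [[_ spark] E cardEn c c0|indep].
  pose s := [seq f g | g <- enum E].
  have s_uniq : uniq s by rewrite map_inj_uniq ?enum_uniq.
  pose S := seq_fset tt s.
  have /spark : [set` S] `<=` range f.
    by move=> x; rewrite /= seq_fsetE => /mapP[g _ ->]; exists g.
  rewrite size_seq_fset undup_id// size_map -cardE => /(_ cardEn).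
  move=> /basis_free; rewrite (perm_free (seq_fset_perm tt s)).
  by rewrite undup_id// => /free_imageP; exact.
split.
  exists #|{: bool * 'I_m.+1}|.
    by rewrite card_prod card_bool card_ord mul2n -addnn leq_addr.
  apply: card_eq_trans (inj_card_eq (f := f) _) _; first exact: in2W.
  apply: card_eq_trans (card_esym card_II).
  have enum_rank_inj2 : {in [set: bool * 'I_m.+1] &, injective enum_rank}.
    by move=> g h _ _ /enum_rank_inj.
  apply: card_eq_trans (card_esym (inj_card_eq enum_rank_inj2)) _.
  rewrite (_ : range enum_rank = setT) ?card_eqxx//.
  by apply/seteqP; split=> // i _; exists (enum_val i); rewrite ?enum_valK.
move=> S Sf cardS; pose E := [set g | f g \in S]%SET.
have SE : perm_eq S [seq f g | g <- enum E].
  apply: uniq_perm; rewrite ?fset_uniq ?map_inj_uniq ?enum_uniq// => x.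
  apply/idP/mapP => [xS|[g]].
    by have [g _ gx] := Sf _ xS; exists g; rewrite // mem_enum inE gx.
  by rewrite mem_enum inE => ? ->.
have cardEn : #|E| = m.+1.
  by rewrite [LHS]cardE -(size_map f) -(perm_size SE).
rewrite basisEfree (perm_free SE) subvf dimvf dim_matrix mulr1.
by rewrite cardS leqnn !andbT; apply/free_imageP; exact: indep.
Qed.

(** * Generic vectors *)

(** The whole space is not null, since its measure is a product of nonzero
    factors. *)
Lemma ae_tuple_lebesgue_ex (R : realType) k
    (P : k.-tuple (measurableTypeR R) -> Prop) :
  {ae tuple_lebesgue R k, forall x, P x} -> exists x, P x.
Proof.
move=> [N [mN N0 PN]]; apply: contrapT => noP.
have NT : N = [set w | forall i : 'I_k, [set: measurableTypeR R] (tnth w i)].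
  by apply/seteqP; split=> // x _; apply: PN => /= Px; apply: noP; exists x.
have /eqP : (\prod_(i < k) lebesgue_measure [set: measurableTypeR R] = 0)%E.
  by rewrite -(tuple_lebesgue_box (A := fun=> setT)) -?NT.
apply/negP; elim/big_ind: _ => [|x y x0 y0|i _]; first by rewrite onee_neq0.
  by rewrite mule_neq0.
have : (lebesgue_measure (`[0%R, 1%R]%classic : set R) <=
        lebesgue_measure [set: R])%E.
  by apply: le_measure; rewrite ?inE.
apply: contraL => /eqP ->.
by rewrite lebesgue_measure_itv/= lte01 sube0 -ltNge lte01.
Qed.

Section generic_vectors.
Variables (R : realType) (n : nat).
Local Notation C := R[i].

Lemma cvec_of_tuple_surj (v : 'cV[C]_n) : exists x, cvec_of_tuple x = v.
Proof.
exists [tuple match fintype.split i with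
              | inl j => complex.Re (v j 0)
              | inr j => complex.Im (v j 0) end | i < n + n].
apply/colP => j; rewrite mxE !tnth_mktuple.
by rewrite !(unsplitK (inl _)) !(unsplitK (inr _)); case: (v j 0).
Qed.

Lemma mpoly_fun_coord j :
  mpoly_fun (fun x => cvec_of_tuple (R := R) (n := n) x j 0).
Proof.
rewrite (_ : (fun x => _) = fun x : (n + n).-tuple (measurableTypeR R) =>
  (tnth x (lshift n j) : R)%:C + Complex 0 1 * (tnth x (rshift n j) : R)%:C).
  apply: mpoly_funD; first exact: mpoly_fun_tnth.
  by apply: mpoly_funM; [exact: mpoly_fun_cst|exact: mpoly_fun_tnth].
apply/funext => x; rewrite mxE; apply/eqP; rewrite eq_complex /=.
by rewrite !mul0r !mulr0 !mul1r !subr0 !addr0 !add0r !eqxx.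
Qed.

Lemma ae_cvec_neq0 (P : 'cV[C]_n -> C) v :
  mpoly_fun (fun x => P (cvec_of_tuple x)) -> P v != 0 ->
  ae_cvec (fun u => P u != 0).
Proof.
have [x <-] := cvec_of_tuple_surj v => pP Px.
exists [set y | P (cvec_of_tuple y) = 0]; split.
- exact: (measurable_zeros pP).
- exact: (mpoly_fun_zeros_null pP Px).
- by move=> y /= /negP; rewrite negbK => /eqP.
Qed.

Lemma ae_cvec_distinct_coords :
  ae_cvec (fun v : 'cV[C]_n => injective (fun j => v j 0)).
Proof.
pose P (ij : 'I_n * 'I_n) (v : 'cV[C]_n) :=
  ij.1 != ij.2 -> v ij.1 0 - v ij.2 0 != 0.
have: ae_cvec (fun v => forall ij, P ij v).
  apply: filter_forall => -[i j]; rewrite /P /=.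
  have [_|ij] := eqVneq i j; first exact: filterE.
  suff : ae_cvec (fun v : 'cV[C]_n => v i 0 - v j 0 != 0).
    by rewrite /ae_cvec; apply: filterS => x vij _.
  apply: (ae_cvec_neq0 (v := delta_mx i 0)).
    rewrite (_ : (fun x => _) = fun x => cvec_of_tuple x i 0 +
                                  (-1) * cvec_of_tuple x j 0).
      apply: mpoly_funD; first exact: mpoly_fun_coord.
      by apply: mpoly_funM; [exact: mpoly_fun_cst|exact: mpoly_fun_coord].
    by apply/funext => x; rewrite mulN1r.
  by rewrite !mxE !eqxx [j == i]eq_sym (negPf ij) subr0 oner_eq0.
rewrite /ae_cvec; apply: filterS => x vP i j /eqP; rewrite -subr_eq0 => vij.
by apply/eqP/negP => /negP ij; case/negP: (vP (i, j) ij).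
Qed.

End generic_vectors.

(** The rows of the matrix are the n vectors, numbered by the enumeration of E;
    a left kernel vector of the matrix is a linear relation among them. *)
Lemma det_indepP (K : fieldType) n (T : finType) (f : T -> 'cV[K]_n)
    (E : {set T}) (cardE : #|E| = n) :
  \det (\matrix_(i, j) f (enum_val (cast_ord (esym cardE) i)) j 0) != 0 <->
  forall c : T -> K, \sum_(x in E) c x *: f x = 0 ->
    forall x, x \in E -> c x = 0.
Proof.
case: n / cardE in f *; set M := \matrix_(i, j) _.
have MP (c : T -> K) (u : 'rV_#|E|) : (forall i, u 0 i = c (enum_val i)) ->
    u *m M = 0 <-> \sum_(x in E) c x *: f x = 0.
  move=> uc; have -> : \sum_(x in E) c x *: f x = (u *m M)^T.
    rewrite big_enum_val; apply/colP => j; rewrite mxE summxE mxE.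
    by apply: eq_bigr => i _; rewrite !mxE uc cast_ord_id.
  by split=> [->|/(congr1 trmx)]; rewrite ?trmxK trmx0.
split=> [detM c c0 x xE|indep].
  pose u : 'rV_#|E| := \row_i c (enum_val i).
  have u0 : u = 0.
    apply/eqP; apply: contraNT detM => uN0; apply/det0P; exists u => //.
    by apply: (MP c u _).2 => // i; rewrite mxE.
  by have := congr1 (fun u : 'rV_#|E| => u 0 (enum_rank_in xE x)) u0;
    rewrite !mxE enum_rankK_in.
apply/negP => /det0P[u /rV0Pn[i ui0] uM0].
pose c x := u 0 (enum_rank_in (enum_valP i) x).
have uc j : u 0 j = c (enum_val j) by rewrite /c enum_valK_in.
by case/negP: ui0; rewrite uc; apply/eqP/indep/enum_valP; apply/(MP c u uc).
Qed.

(** * The odd and the even case *)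

Lemma big_dihedral (m : nat) (V : nmodType) (E : {set bool * 'I_m.+1})
    (F : bool * 'I_m.+1 -> V) :
  \sum_(g in E) F g = \sum_(a | (false, a) \in E) F (false, a) +
                      \sum_(b | (true, b) \in E) F (true, b).
Proof.
rewrite big_mkcond [X in X + _]big_mkcond [X in _ + X]big_mkcond /= addrC.
rewrite -(big_bool _ (fun e => \sum_k if (e, k) \in E then F (e, k) else 0)).
by rewrite pair_bigA; apply: eq_bigr => -[].
Qed.

Section dihedral_frames.
Variables (R : realType) (m : nat).
Local Notation n := m.+1.
Local Notation C := R[i].
Local Notation G := (bool * 'I_n)%type.

(** There are finitely many sets E, and for each of them the determinant of the
    family is a polynomial that does not vanish at the vector provided by
    [dihedral_family_indep]. *)
Lemma ae_dihedral_indep : odd n ->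
  ae_cvec (fun v : 'cV[C]_n => forall E : {set G}, #|E| = n ->
    forall c : G -> C, \sum_(g in E) c g *: (dmx R g *m v) = 0 ->
    forall g, g \in E -> c g = 0).
Proof.
move=> n_odd; apply: filter_forall => E.
have [/eqP cardEn|cardEn] := boolP (#|E| == n); last first.
  by apply: filterE => x /= /eqP; rewrite (negPf cardEn).
have [w w_prim] := closed_prim_root_exists C (ltn0Sn m).
pose A : {set 'I_n} := [set a | (false, a) \in E]%SET.
pose B : {set 'I_n} := [set b | (true, b) \in E]%SET.
have cardAB : (#|A| + #|B| = n)%N.
  rewrite -[RHS]cardEn -!sum1_card [RHS]big_dihedral.
  by congr (_ + _)%N; apply: eq_bigl => k; rewrite inE.
have [z zP] := dihedral_family_indep w_prim n_odd cardAB.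
pose P (v : 'cV[C]_n) := \det (\matrix_(i < n, j < n)
  (dmx R (enum_val (cast_ord (esym cardEn) i)) *m v) j 0).
suff : ae_cvec (fun v => P v != 0).
  rewrite /ae_cvec; apply: filterS => x.
  by move=> /(det_indepP (fun g => dmx R g *m cvec_of_tuple x)).
apply: (ae_cvec_neq0 (v := \col_j z j)).
  apply: mpoly_fun_det => i j.
  by under eq_fun do rewrite mxE dmxE; exact: mpoly_fun_coord.
apply/(det_indepP (fun g => dmx R g *m _)) => c c0.
have [j|cA cB] := zP (fun a => c (false, a)) (fun b => c (true, b)).
  have := congr1 (fun u : 'cV[C]_n => u j 0) c0.
  rewrite big_dihedral !mxE !summxE => c0j; rewrite -[RHS]c0j.
  by congr (_ + _); apply: eq_big => k; rewrite ?inE// => _;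
    rewrite mxE dmxE mxE.
by case=> [[] k] kE; [apply: cB|apply: cA]; rewrite inE.
Qed.

(** At coordinate j, the substitution a |-> 2j - a turns v(j - a) into v(a - j);
    it preserves parity because n is even. *)
Lemma even_relation (v : 'cV[C]_n) : ~~ odd n ->
  \sum_(a : 'I_n | ~~ odd a) dmx R (false, a) *m v =
  \sum_(b : 'I_n | ~~ odd b) dmx R (true, b) *m v.
Proof.
move=> n_even; apply/colP => j; rewrite !summxE.
have refl_inj : injective (fun a => j + j - a).
  by apply: inj_comp (addrI _) oppr_inj.
rewrite (reindex_inj refl_inj) /=; apply: eq_big => b /=.
  rewrite !odd_mod ?(negPf n_even)// oddD !odd_mod ?(negPf n_even)// oddD.
  by rewrite addbb oddB ?(negPf n_even)// ltnW.
by move=> _; rewrite !dmxE /dact /= opprB addrCA opprD addNKr.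
Qed.

(** Since n is even, translation by 1 exchanges even and odd residues. *)
Lemma card_even_half : ~~ odd n ->
  #|[set g : G | ~~ odd g.2]%SET| = n.
Proof.
move=> n_even; rewrite -sum1_card [LHS]big_dihedral.
have n_gt1 : (1 < n)%N by case: (m) n_even.
transitivity (\sum_(k < n) 1)%N; last by rewrite sum1_card card_ord.
rewrite [RHS](bigID (fun k : 'I_n => ~~ odd k)) /=.
congr (_ + _)%N; first by apply: eq_bigl => k; rewrite inE.
rewrite [RHS](reindex_inj (addIr (inZp 1))) /=; apply: eq_bigl => k.
rewrite inE /= negbK odd_mod ?(negPf n_even)// oddD (modn_small n_gt1).
by rewrite addbT.
Qed.

End dihedral_frames.

Theorem corollary3 (R : realType) (n : nat) (n_gt2 : (2 < n)%N) :
  ae_cvec (fun v : 'cV[R[i]]_n => full_spark_frame (dihedral_orbit v)) <-> odd n.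
Proof.
case: n => [//|m] in n_gt2 *; have n_gt1 := ltnW n_gt2; split=> [spark|n_odd].
  apply: contraT => n_even.
  have [x [x_spark x_inj]] := ae_tuple_lebesgue_ex
    (filterI spark (@ae_cvec_distinct_coords R m.+1)).
  have f_inj := dmx_orbit_inj n_gt1 n_gt2 x_inj.
  have evenE e (k : 'I_m.+1) :
      ((e, k) \in [set g : bool * 'I_m.+1 | ~~ odd g.2]%SET) = ~~ odd k.
    by rewrite inE.
  (* Even rotations minus even reflections: n group elements, sum zero. *)
  have := (full_sparkP n_gt2 f_inj).1 x_spark _ (card_even_half n_even)
    (fun g => if g.1 then -1 else 1).
  rewrite big_dihedral /= !(eq_bigl _ _ (evenE _)).
  under eq_bigr do rewrite scale1r.
  under [X in _ + X]eq_bigr do rewrite scaleN1r.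
  rewrite sumrN => /(_ _ (false, 0)); rewrite inE /= => /(_ _ isT)/eqP.
  rewrite oner_eq0; apply; apply/eqP; rewrite subr_eq0; apply/eqP.
  exact: even_relation.
have := ae_dihedral_indep R n_odd; have := @ae_cvec_distinct_coords R m.+1.
rewrite /ae_cvec; apply: filterS2 => x x_inj indep.
by apply/full_sparkP => //; exact: dmx_orbit_inj x_inj.
Qed.
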